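(* $c_3=\frac{1}{4}$.
   Context: Orientations of finite sets are defined inductively. An orientation of a 1-set $\{x\}$ is an assignment of $+1$ or $-1$ to $x$. An orientation of a 2-set $\{a,b\}$ is a directed edge from $a$ to $b$ or from $b$ to $a$ (a directed edge from $a$ to $b$ is regarded as assigning $+1$ to $b$ and $-1$ to $a$). For $d\ge 3$, an orientation of a $d$-set consists of an orientation of each of its $(d-1)$-subsets such that these are pairwise compatible, where two oriented $(d-1)$-sets sharing a common $(d-2)$-subset are compatible if they give different orientations to that common $(d-2)$-subset. Thus an orientation of a 3-set is the same as a cyclic ordering of it, and each cyclic ordering induces a direction on each of its 2-subsets. A 3-tournament on $n$ vertices is a set of $n$ vertices together with an orientation of each of its 3-subsets. A 4-subset of the vertex set is directed if its four oriented 3-subsets are pairwise compatible, i.e. any two of its 3-subsets have cyclic orderings that induce opposite directions on their common 2-subset. The constant $c_3$ is defined as $\lim_{n\to\infty} M_3(n)/\binom{n}{4}$, where $M_3(n)$ is the greatest number of directed 4-sets in a 3-tournament on $n$ vertices (the limit exists by an averaging argument). *)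

(* Defs.v *)
From HB Require Import structures.
From mathcomp Require Import all_boot all_order all_algebra.
From mathcomp Require Import all_classical all_reals all_analysis.

Set Implicit Arguments.
Unset Strict Implicit.
Unset Printing Implicit Defensive.

Import Order.TTheory GRing.Theory Num.Theory.
Import numFieldNormedType.Exports.

Local Open Scope ring_scope.

Section Orientations.
Variable T : finType.
Implicit Types (e f X Y : {set T}).

Definition subsets_of_card (k : nat) (X : {set T}) : {set {set T}} :=
  [set Y : {set T} | (Y \subset X) && (#|Y| == k)].

(* The pair (a, b) is the directed edge from a to b. *)
Definition is_orientation2 (e : {set T}) (p : T * T) : bool :=
  (p.1 != p.2) && (e == [set p.1; p.2]%SET).

(* The sign which a directed edge assigns to one of its two ends: true is +1
   (the head), false is -1 (the tail). *)
Definition edge_sign (p : T * T) (x : T) : bool := x == p.2.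

(* An orientation of a 3-set X gives an orientation to each 2-subset of X; two
   distinct 2-subsets of X meet in a 1-set, to which they must give different
   signs. The values of o at sets that are not 2-subsets of X are irrelevant. *)
Definition is_orientation3 (X : {set T}) (o : {ffun {set T} -> T * T}) : bool :=
  [forall e in subsets_of_card 2 X, is_orientation2 e (o e)] &&
  [forall e in subsets_of_card 2 X, forall f in subsets_of_card 2 X,
     (e != f) ==>
     [forall x in e :&: f, edge_sign (o e) x != edge_sign (o f) x]].

Definition is_tournament3
    (t : {ffun {set T} -> {ffun {set T} -> T * T}}) : bool :=
  [forall X in subsets_of_card 3 [set: T], is_orientation3 X (t X)].

(* Two distinct 3-subsets of a 4-set meet in a 2-set. *)
Definition directed4
    (t : {ffun {set T} -> {ffun {set T} -> T * T}}) (Y : {set T}) : bool :=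
  (#|Y| == 4%N) &&
  [forall X in subsets_of_card 3 Y, forall X' in subsets_of_card 3 Y,
     (X != X') ==> (t X (X :&: X') != t X' (X :&: X'))].

End Orientations.

Definition M3 (n : nat) : nat :=
  \max_(t : {ffun {set 'I_n} -> {ffun {set 'I_n} -> 'I_n * 'I_n}}
        | is_tournament3 t) #|[set Y : {set 'I_n} | directed4 t Y]|.

Definition density3 (R : realType) (n : nat) : R := (M3 n)%:R / 'C(n, 4)%:R.

Definition c3 (R : realType) : R := limn (density3 R).

(* Main.v *)
Require Import Defs.
From HB Require Import structures.
From mathcomp Require Import all_boot all_order all_algebra.
From mathcomp Require Import all_classical all_reals all_analysis.
From mathcomp Require Import zify ring lra.
Import Order.TTheory GRing.Theory Num.Theory.
Import numFieldNormedType.Exports.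
Set Implicit Arguments.
Unset Strict Implicit.
Unset Printing Implicit Defensive.
Local Open Scope ring_scope.

(** Upper bound. In a 4-set with its four oriented triples, call a pair
    balanced if the two triples through it direct it oppositely. If k of the
    four triples agree with a fixed directed orientation of the 4-set, then
    C(k, 2) + C(4 - k, 2) of its six pairs are balanced: all six when the 4-set
    is directed, and at least two in any case ([balanced_edges]). On the other
    hand, a pair a, b lies in n - 2 triples, so it is balanced in at most
    (n - 2)^2 / 4 of the 4-sets through it ([balanced_at_edge]). Counting
    balanced pairs in both ways gives
    96 M <= n^2 (n - 1) (n - 2) for the number M of directed 4-sets
    ([directed_le]), a bound for M that is asymptotic to C(n, 4) / 4.

    Lower bound. For both estimates to be sharp, k has to be even for almost
    every 4-set. This parity holds throughout when the signs of the triples are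
    sums modulo 2 of the arcs of an ordinary tournament, since each arc lies in
    two triples of a 4-set. So take a random tournament, and orient a, b, c as
    the cycle a -> b -> c -> a exactly when an odd number of the arcs ab, bc, ca
    agree with that cycle. A 4-set is then directed as soon as two parity
    conditions hold, and each of them can be toggled without affecting the
    other by reversing one arc; so every 4-set is directed with probability at
    least 1/4 ([directed_quarter]), and some choice makes at least a quarter of
    the 4-sets directed ([M3_ge]).

    Hence the density lies between 1/4 and n / (4 (n - 3)), and it converges
    to 1/4. *)

(** * Faces of sets of size three and four *)

Section SmallSets.

Local Open Scope nat_scope.
Local Open Scope set_scope.

Variable T : finType.
Implicit Types (X Y e f : {set T}) (a b c d : T).

Lemma uniq3P a b c :
  uniq [:: a; b; c] = [&& a != b, a != c & b != c].
Proof. by rewrite /= !inE negb_or andbT -andbA. Qed.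

Lemma uniq4P a b c d :
  uniq [:: a; b; c; d] =
  [&& a != b, a != c, a != d, b != c, b != d & c != d].
Proof. by rewrite /= !inE !negb_or andbT -!andbA. Qed.

Lemma set3_cycle a b c : [set a; b; c] = [set b; c; a].
Proof. by apply/setP=> x; rewrite !inE -orbA orbC. Qed.

Lemma set3_swap a b c : [set a; b; c] = [set b; a; c].
Proof. by rewrite (finset.setUC [set a] [set b]). Qed.

Lemma set3_mem a b c : [set a; b; c] = [set x in [:: a; b; c]].
Proof. by apply/setP=> x; rewrite !inE -orbA. Qed.

Lemma set4_mem a b c d : [set a; b; c; d] = [set x in [:: a; b; c; d]].
Proof. by apply/setP=> x; rewrite !inE -!orbA. Qed.

Lemma card_set3 a b c : uniq [:: a; b; c] -> #|[set a; b; c]| = 3.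
Proof. by move=> u; rewrite set3_mem cardsE (card_uniqP u). Qed.

Lemma card_set4 a b c d : uniq [:: a; b; c; d] -> #|[set a; b; c; d]| = 4.
Proof. by move=> u; rewrite set4_mem cardsE (card_uniqP u). Qed.

Lemma set4P Y : #|Y| = 4 ->
  exists a b c d, uniq [:: a; b; c; d] /\ Y = [set a; b; c; d].
Proof.
move=> cY; have := enum_uniq (mem Y); have := set_enum Y; move: cY.
rewrite cardE; case: (enum _) => [|a [|b [|c [|d [|? ?]]]]] //= _ <- u.
by exists a, b, c, d; rewrite set4_mem.
Qed.

Lemma set3_edge X e : #|X| = 3 -> e \subset X -> #|e| = 2 ->
  exists a b c, [/\ uniq [:: a; b; c], e = [set a; b] & X = [set a; b; c]].
Proof.
move=> cX sub /eqP/cards2P[a [b [ab eE]]].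
have : #|X :\: e| == 1 by rewrite cardsDS // cX eE cards2 ab.
move=> /cards1P[c cE].
have ce : c \in X :\: e by rewrite cE set11.
exists a, b, c; split=> //; last first.
  by rewrite -eE -cE -{1}(finset.setID X e) (finset.setIidPr sub).
move: ce; rewrite uniq3P ab eE !inE negb_or => /andP[/andP[ca cb] _].
by rewrite eq_sym ca eq_sym cb.
Qed.

Lemma set3_edge_at X e a : #|X| = 3 -> e \subset X -> #|e| = 2 -> a \in e ->
  exists b c, [/\ uniq [:: a; b; c], e = [set a; b] & X = [set a; b; c]].
Proof.
move=> cX eX ce; have [x [y [z [u -> ->]]]] := set3_edge cX eX ce.
move=> /set2P[->|->]; first by exists y, z.
exists x, z; split; [|exact: finset.setUC|exact: set3_swap].
by move: u; rewrite !uniq3P (eq_sym y x) => /and3P[-> -> ->].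
Qed.

Lemma set3_edges X e f a : #|X| = 3 -> e \subset X -> f \subset X ->
    #|e| = 2 -> #|f| = 2 -> e != f -> a \in e -> a \in f ->
  exists b c, [/\ uniq [:: a; b; c], e = [set a; b], f = [set a; c]
                & X = [set a; b; c]].
Proof.
move=> cX eX fX ce cf ef ae af.
have [b [c [u eE XE]]] := set3_edge_at cX eX ce ae.
have [c' [? [u' fE _]]] := set3_edge_at cX fX cf af.
exists b, c; split=> //.
have /(fintype.subsetP fX) : c' \in f by rewrite fE set22.
rewrite XE !inE => /orP[/orP[]|] /eqP c'E; last by rewrite fE c'E.
  by move: u'; rewrite uniq3P c'E eqxx.
by move: ef; rewrite eE fE c'E eqxx.
Qed.

(** A pair of triples compared by [directed4] meets in an edge and differs in
    one vertex each, so directedness only concerns an edge and two further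
    vertices. *)
Lemma set4_faces Y X X' : #|Y| = 4 -> X \subset Y -> X' \subset Y ->
    #|X| = 3 -> #|X'| = 3 -> X != X' ->
  exists a b x y, [/\ uniq [:: a; b; x; y], X = [set a; b; x],
    X' = [set a; b; y] & X :&: X' = [set a; b]].
Proof.
move=> cY XY X'Y cX cX' XX'.
have cU : #|X :|: X'| <= 4 by rewrite -cY subset_leq_card // finset.subUset XY.
have cI : #|X :&: X'| < 3.
  rewrite ltnNge; apply: contra XX' => c3.
  have IX : X :&: X' = X by apply/eqP; rewrite eqEcard finset.subsetIl cX.
  by rewrite eqEcard cX cX' leqnn -IX finset.subsetIr.
have {cU}cI : #|X :&: X'| = 2 by have := cardsUI X X'; rewrite cX cX'; lia.
have [a [b [x [u IE XE]]]] := set3_edge cX (finset.subsetIl X X') cI.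
have [a' [b' [y [u' IE' XE']]]] := set3_edge cX' (finset.subsetIr X X') cI.
exists a, b, x, y; split=> //; last by rewrite XE' -IE' -IE.
have yX : y \notin X.
  apply/negP => yX; have : y \in X :&: X' by rewrite inE yX XE' !inE eqxx orbT.
  move: u'; rewrite uniq3P IE' !inE => /and3P[_ + +].
  by rewrite (eq_sym a') (eq_sym b') => /negPf-> /negPf->.
move: u yX; rewrite uniq3P uniq4P XE !inE !negb_or.
move=> /and3P[-> -> ->] /andP[/andP[]].
by rewrite !(eq_sym y) => -> -> ->.
Qed.

End SmallSets.

(** * The sign of an ordered triple *)

Section Positive.

Local Open Scope nat_scope.
Local Open Scope set_scope.

Variable T : finType.
Implicit Types (X Y e f : {set T}) (a b c d : T).
Implicit Types (t : {ffun {set T} -> {ffun {set T} -> T * T}}).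

(** The cyclic order of a triple as a sign: whether a -> b -> c -> a is the
    orientation of {a, b, c}, read off from the edge {a, b}. *)
Definition pos t a b c : bool := t [set a; b; c] [set a; b] == (a, b).

Variable t : {ffun {set T} -> {ffun {set T} -> T * T}}.
Hypothesis tour : is_tournament3 t.

Lemma tournament_edge a b c : uniq [:: a; b; c] ->
  t [set a; b; c] [set a; b] = if pos t a b c then (a, b) else (b, a).
Proof.
move=> u; rewrite /pos; case: eqP => // ne.
have /forall_inP/(_ [set a; b; c]) := tour.
rewrite inE finset.subsetT card_set3 // => /(_ isT)/andP[/forall_inP/(_ [set a; b])].
have ab : a != b by move: u; rewrite uniq3P => /andP[].
rewrite inE finset.subsetUl cards2 ab => /(_ isT)/andP[]; move: ne.
case: (t _ _) => x y /= ne xy /eqP E _.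
have /set2P xab : x \in [set a; b] by rewrite E set21.
have /set2P yab : y \in [set a; b] by rewrite E set22.
by case: xab yab ne xy => -> [] -> //; rewrite eqxx.
Qed.

Lemma posN a b c : uniq [:: a; b; c] -> pos t b a c = ~~ pos t a b c.
Proof.
move=> u; rewrite {1}/pos -set3_swap (finset.setUC [set b]) (tournament_edge u).
have ab : a != b by move: u; rewrite uniq3P => /andP[].
by case: ifP => _; rewrite ?eqxx // xpair_eqE (negPf ab).
Qed.

Lemma edge_signE a b c : uniq [:: a; b; c] ->
  (edge_sign (t [set a; b; c] [set a; b]) b = pos t a b c) *
  (edge_sign (t [set a; b; c] [set a; b]) a = ~~ pos t a b c).
Proof.
move=> u; rewrite (tournament_edge u) /edge_sign.
have ab : a != b by move: u; rewrite uniq3P => /andP[].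
by split; case: ifP => _ /=; rewrite ?eqxx ?(eq_sym b) ?(negPf ab).
Qed.

(** Edges of a triple that share a vertex give it different signs, so the
    directions of the three edges follow one another around a cycle. *)
Lemma pos_cycle a b c : uniq [:: a; b; c] -> pos t b c a = pos t a b c.
Proof.
move=> u; have u' : uniq [:: b; c; a] by rewrite -(rot_uniq 1) in u.
have /forall_inP/(_ [set a; b; c]) := tour.
rewrite inE finset.subsetT card_set3 // => /(_ isT)/andP[_].
move: (u); rewrite uniq3P => /and3P[ab ac bc].
move=> /forall_inP/(_ [set a; b]).
rewrite inE finset.subsetUl cards2 ab => /(_ isT)/forall_inP/(_ [set b; c]).
rewrite inE {1}set3_cycle finset.subsetUl cards2 bc => /(_ isT).
have -> /= : [set a; b] != [set b; c].
  by apply/eqP=> /setP/(_ a); rewrite !inE eqxx (negPf ab) (negPf ac).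
move=> /forall_inP/(_ b); rewrite !inE eqxx orbT => /(_ isT).
rewrite (edge_signE u) set3_cycle (edge_signE u').
by case: (pos t a b c) (pos t b c a) => [] [].
Qed.

Lemma pos_swap a b c : uniq [:: a; b; c] -> pos t a c b = ~~ pos t a b c.
Proof.
move=> u; rewrite -posN // (pos_cycle (a := b)) //.
move: u; rewrite !uniq3P (eq_sym b a) => /and3P[-> -> ->]; by [].
Qed.

Lemma neq_pos a b x y : uniq [:: a; b; x; y] ->
  (t [set a; b; x] [set a; b] != t [set a; b; y] [set a; b])
  = (pos t a b x != pos t a b y).
Proof.
rewrite uniq4P => /and5P[ab ax ay bx /andP[b_y xy]].
rewrite !tournament_edge ?uniq3P ?ab ?ax ?ay ?bx //.
case: (pos t a b x) (pos t a b y) => [] [];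
  by rewrite ?eqxx ?xpair_eqE ?(eq_sym b) ?(negPf ab).
Qed.

Lemma directed4_pos Y a b x y : directed4 t Y ->
    uniq [:: a; b; x; y] -> {subset [:: a; b; x; y] <= Y} ->
  pos t a b x != pos t a b y.
Proof.
move=> /andP[/eqP cY /forall_inP dir] u sub; rewrite -neq_pos //.
have [aY bY xY yY] : [/\ a \in Y, b \in Y, x \in Y & y \in Y].
  by split; apply: sub; rewrite !inE eqxx ?orbT.
have := u; rewrite uniq4P => /and5P[ab ax ay bx /andP[b_y xy]].
have IE : [set a; b; x] :&: [set a; b; y] = [set a; b].
  apply/setP=> z; rewrite !inE.
  by rewrite -orb_andr; case: (eqVneq z x) => [->|_]; rewrite ?(negPf xy) orbF.
have := dir [set a; b; x].
rewrite inE !finset.subUset !finset.sub1set aY bY xY card_set3 ?uniq3P ?ab ?ax //.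
move=> /(_ isT)/forall_inP/(_ [set a; b; y]).
rewrite inE !finset.subUset !finset.sub1set aY bY yY card_set3 ?uniq3P ?ab ?ay //.
move=> /(_ isT)/implyP.
rewrite IE; apply; apply/eqP => /setP/(_ x).
by rewrite !inE eqxx orbT (negPf xy) !(eq_sym x) (negPf ax) (negPf bx).
Qed.

Lemma pos_directed4 Y : #|Y| = 4 ->
    (forall a b x y, uniq [:: a; b; x; y] -> {subset [:: a; b; x; y] <= Y} ->
       pos t a b x != pos t a b y) ->
  directed4 t Y.
Proof.
move=> cY dir; rewrite /directed4 cY eqxx.
apply/forall_inP=> X /[!inE] /andP[XY /eqP cX].
apply/forall_inP=> X' /[!inE] /andP[X'Y /eqP cX']; apply/implyP=> ne.
have [a [b [x [y [u XE X'E IE]]]]] := set4_faces cY XY X'Y cX cX' ne.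
rewrite IE XE X'E neq_pos // dir // => z; rewrite !inE => /or4P[]/eqP->.
- by apply: (fintype.subsetP XY); rewrite XE !inE eqxx.
- by apply: (fintype.subsetP XY); rewrite XE !inE eqxx orbT.
- by apply: (fintype.subsetP XY); rewrite XE !inE eqxx orbT.
- by apply: (fintype.subsetP X'Y); rewrite X'E !inE eqxx orbT.
Qed.

(** Ordered quadruples, with the pair first: the symmetric group then moves any
    of the six pairs of a 4-set to the front. *)
Definition balanced a b c d : bool :=
  uniq [:: a; b; c; d] && (pos t a b c != pos t a b d).

(** By [pos_cycle] and [pos_swap] all signs are functions of those of abc, abd,
    acd and bcd; the bound is checked on the sixteen values of these four
    signs. *)
Lemma balanced_edges a b c d : uniq [:: a; b; c; d] ->
  2 + 4 * directed4 t [set a; b; c; d] <=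
  balanced a b c d + balanced a c b d + balanced a d b c
  + balanced b c a d + balanced b d a c + balanced c d a b.
Proof.
move=> u; set Y := [set a; b; c; d].
have := u; rewrite uniq4P => /and5P[ab ac ad bc /andP[bd cd]].
have ne : (b != a) * (c != a) * (d != a) * (c != b) * (d != b) * (d != c).
  by do !split; rewrite eq_sym.
have pe : (pos t a c b = ~~ pos t a b c) * (pos t a d b = ~~ pos t a b d)
   * (pos t a d c = ~~ pos t a c d) * (pos t b c a = pos t a b c)
   * (pos t b d a = pos t a b d) * (pos t b d c = ~~ pos t b c d)
   * (pos t c d a = pos t a c d) * (pos t c d b = pos t b c d).
  by do !split; first [apply: pos_swap | apply: pos_cycle];
    rewrite uniq3P ?ab ?ac ?ad ?bc ?bd ?cd.
have dirP x y z w : x \in Y -> y \in Y -> z \in Y -> w \in Y ->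
    uniq [:: x; y; z; w] -> directed4 t Y -> pos t x y z != pos t x y w.
  move=> xY yY zY wY u' D; apply: directed4_pos D u' _.
  by apply/allP; rewrite /= xY yY zY wY.
have [aY bY cY dY] : [/\ a \in Y, b \in Y, c \in Y & d \in Y].
  by split; rewrite !inE eqxx ?orbT.
(* Three balanced edges already make all four signs alternate. *)
have D1 := dirP _ _ _ _ aY bY cY dY.
have D2 := dirP _ _ _ _ aY cY bY dY.
have D3 := dirP _ _ _ _ bY cY aY dY.
rewrite /balanced; move: D1 D2 D3.
rewrite !uniq4P !ne ab ac ad bc bd cd /= !pe.
case: (directed4 t Y) => [|_ _ _].
  move=> /(_ isT isT) + /(_ isT isT) + /(_ isT isT).
  by case: (pos t a b c) (pos t a b d) (pos t a c d) (pos t b c d) => [] [] [] [].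
by case: (pos t a b c) (pos t a b d) (pos t a c d) (pos t b c d) => [] [] [] [].
Qed.

End Positive.

(** * Sums over ordered quadruples *)

Section SumOverQuadruples.

Local Open Scope nat_scope.
Local Open Scope set_scope.

Variable T : finType.
Implicit Types (F : T -> T -> T -> T -> nat).

Definition sum4 F := \sum_a \sum_b \sum_c \sum_d F a b c d.

Lemma leq_sum4 F G : (forall a b c d, F a b c d <= G a b c d) -> sum4 F <= sum4 G.
Proof. by move=> le; do 4![apply: leq_sum => ? _]; apply: le. Qed.

Lemma sum4D F G : sum4 (fun a b c d => F a b c d + G a b c d) = sum4 F + sum4 G.
Proof.
rewrite /sum4 -big_split; apply: eq_bigr => a _.
rewrite -big_split; apply: eq_bigr => b _.
by rewrite -big_split; apply: eq_bigr => c _; rewrite -big_split.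
Qed.

Lemma sum4_swap12 F : sum4 (fun a b c d => F b a c d) = sum4 F.
Proof. exact: exchange_big. Qed.

Lemma sum4_swap23 F : sum4 (fun a b c d => F a c b d) = sum4 F.
Proof. by apply: eq_bigr => a _; apply: exchange_big. Qed.

Lemma sum4_swap34 F : sum4 (fun a b c d => F a b d c) = sum4 F.
Proof. by apply: eq_bigr => a _; apply: eq_bigr => b _; apply: exchange_big. Qed.

Lemma card_enumerations (Y : {set T}) : #|Y| = 4 ->
  #|[set q : 4.-tuple T | uniq q && ([set x in q] == Y)]| = 24.
Proof.
move=> cY; have cE := card_uniq_tuples 4 (mem Y).
rewrite (_ : 24 = #|Y| ^_ 4); last by rewrite cY.
rewrite -cE.
apply: eq_card => q; rewrite !inE andbC; case: (boolP (uniq q)) => u.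
  rewrite !andbT eqEcard cY cardsE (card_uniqP u) size_tuple leqnn andbT.
  apply/fintype.subsetP/allP => h x; last by rewrite inE; apply: h.
  by move=> xq; apply: h; rewrite inE.
by rewrite !andbF.
Qed.

(** Passes from 4-sets to their 4! = 24 enumerations, where averaging over the
    six pairs becomes a permutation of the summation variables. *)
Lemma sum4_sets (F : {set T} -> nat) :
  sum4 (fun a b c d => if uniq [:: a; b; c; d] then F [set a; b; c; d] else 0)
  = 24 * \sum_(Y : {set T} | #|Y| == 4) F Y.
Proof.
pose tup (q : T * T * T * T) := [tuple q.1.1.1; q.1.1.2; q.1.2; q.2].
pose quad (q : 4.-tuple T) :=
  (tnth q (inord 0), tnth q (inord 1), tnth q (inord 2), tnth q (inord 3)).
have tupK : cancel tup quad.
  by move=> [[[a b] c] d]; rewrite /quad !(tnth_nth a) /= !inordK.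
have quadK : cancel quad tup.
  case=> s /= s4; apply: val_inj => /=; move: s4.
  case: s => [|a [|b [|c [|d [|? ?]]]]] //= s4.
  by rewrite !(tnth_nth a) /= !inordK.
rewrite /sum4 pair_bigA pair_bigA pair_bigA /=.
rewrite (reindex quad) /=; last by exists tup => q _; [apply: quadK | apply: tupK].
rewrite -big_mkcond /= (eq_bigl (fun q : 4.-tuple T => uniq q)); last first.
  by move=> q; rewrite -[in RHS](quadK q).
rewrite (eq_bigr (fun q : 4.-tuple T => F [set x in q])); last first.
  by move=> q _; rewrite set4_mem -[in RHS](quadK q).
rewrite (partition_big (fun q : 4.-tuple T => [set x in q])
  (fun Y : {set T} => #|Y| == 4)) /=; last first.
  by move=> q u; rewrite cardsE (card_uniqP u) size_tuple.
rewrite big_distrr; apply: eq_bigr => Y /eqP cY.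
rewrite (eq_bigr (fun=> F Y)); last by move=> q /andP[_ /eqP->].
by rewrite sum_nat_const -(card_enumerations cY) cardsE.
Qed.

End SumOverQuadruples.

(** * The upper bound *)

Section UpperBound.

Local Open Scope nat_scope.
Local Open Scope set_scope.

Variable T : finType.
Variable t : {ffun {set T} -> {ffun {set T} -> T * T}}.

(** If k of the m = n - 2 other vertices are on the positive side of the edge,
    it is balanced for 2 k (m - k) ordered pairs of them, and
    4 k (m - k) <= m^2. *)
Lemma balanced_at_edge a b :
  2 * (\sum_c \sum_d balanced t a b c d) <= (a != b) * (#|T| - 2) ^ 2.
Proof.
case: (eqVneq a b) => [->|ab] /=.
  rewrite big1 // => c _; rewrite big1 // => d _.
  by rewrite /balanced uniq4P eqxx.
pose P := [set c | (c \notin [set a; b]) && pos t a b c].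
pose N := [set c | (c \notin [set a; b]) && ~~ pos t a b c].
have cPN : #|P| + #|N| = #|T| - 2.
  rewrite -(cardsC [set a; b]) cards2 ab addKn -cardsUI.
  have -> : P :|: N = ~: [set a; b].
    by apply/setP=> c; rewrite !inE -andb_orr orbN andbT.
  suff -> : P :&: N = finset.set0 by rewrite cards0 addn0.
  by apply/setP=> c; rewrite !inE; case: (pos t a b c); rewrite ?andbF.
rewrite mul1n -cPN; apply: leq_trans (nat_AGM2 _ _).
rewrite (_ : 4 = 2 * 2) // -mulnA leq_mul2l /= mul2n -addnn {2}mulnC.
have sumE (A B : {set T}) : #|A| * #|B| = \sum_c \sum_d (c \in A) * (d \in B).
  by rewrite -big_distrlr /= -!big_mkcond /= !sum1_card.
rewrite !sumE -big_split; apply: leq_sum => c _.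
rewrite -big_split; apply: leq_sum => d _.
rewrite /balanced uniq4P !inE !negb_or (eq_sym c a) (eq_sym c b) (eq_sym d a)
  (eq_sym d b) ab /=.
by case: (a == c) (b == c) (a == d) (b == d) (pos t a b c) (pos t a b d) (c == d)
  => [] [] [] [] [] [] [].
Qed.

Lemma sum_balanced :
  2 * sum4 (balanced t) <= #|T| * (#|T| - 1) * (#|T| - 2) ^ 2.
Proof.
rewrite /sum4 big_distrr -mulnA -sum_nat_const; apply: leq_sum => a _ /=.
rewrite big_distrr /=.
apply: (@leq_trans (\sum_b (a != b) * (#|T| - 2) ^ 2)).
  by apply: leq_sum => b _; apply: balanced_at_edge.
rewrite -big_distrl leq_mul2r -big_mkcond /= sum1_card subn1 -(cardC1 a).
rewrite eq_leq ?orbT //; apply: eq_card => b.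
by rewrite !inE eq_sym.
Qed.

(** The double count. The six pairs of a quadruple contribute equally to the
    sum over all quadruples, so 24 (2 C(n, 4) + 4 M) <= 6 B, where M is the
    number of directed 4-sets and B the number of balanced quadruples, which
    [sum_balanced] bounds. *)
Lemma directed_le : is_tournament3 t ->
  96 * #|[set Y | directed4 t Y]| <= #|T| ^ 2 * (#|T| - 1) * (#|T| - 2).
Proof.
move=> tour; set D := #|_|; set B := sum4 (balanced t).
have DE : D = \sum_(Y : {set T} | #|Y| == 4) directed4 t Y.
  rewrite /D -sum1_card big_mkcond [RHS]big_mkcond /=; apply: eq_bigr => Y _.
  by rewrite inE /directed4; case: (#|Y| == 4) => //=; case: [forall _ in _, _].
have CE : 'C(#|T|, 4) = \sum_(Y : {set T} | #|Y| == 4) 1.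
  by rewrite sum1_card -card_draws cardsE.
have key : 24 * (2 * 'C(#|T|, 4) + 4 * D) <= 6 * B.
  have -> : 6 * B = sum4 (fun a b c d =>
    balanced t a b c d + balanced t a c b d + balanced t a d b c
    + balanced t b c a d + balanced t b d a c + balanced t c d a b).
    rewrite !sum4D.
    rewrite (sum4_swap23 (balanced t)).
    rewrite (sum4_swap34 (fun a b c d => balanced t a c b d)) (sum4_swap23 (balanced t)).
    rewrite (sum4_swap12 (fun a b c d => balanced t a c b d)) (sum4_swap23 (balanced t)).
    rewrite (sum4_swap34 (fun a b c d => balanced t b c a d)).
    rewrite (sum4_swap12 (fun a b c d => balanced t a c b d)) (sum4_swap23 (balanced t)).
    rewrite (sum4_swap23 (fun a b c d => balanced t b d a c)).
    rewrite (sum4_swap34 (fun a b c d => balanced t b c a d)).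
    rewrite (sum4_swap12 (fun a b c d => balanced t a c b d)) (sum4_swap23 (balanced t)).
    by rewrite -/B; lia.
  rewrite CE DE !big_distrr -big_split -sum4_sets /=.
  apply: leq_sum4 => a b c d; case: ifP => // u.
  by rewrite muln1; apply: balanced_edges.
have := sum_balanced; rewrite -/B.
have := bin_ffact #|T| 4; rewrite (_ : 4`! = 24) // !ffactnS ffactn0 muln1.
case: (#|T|) key => [|[|[|[|n]]]]; rewrite /= ?bin0n ?subn1 ?subn2 /=; lia.
Qed.

End UpperBound.

Lemma M3_le n : (96 * M3 n <= n ^ 2 * (n - 1) * (n - 2))%N.
Proof.
rewrite /M3; elim/big_ind: _ => [|x y xle yle|t tour]; first by rewrite muln0.
  by rewrite maxnMr geq_max xle.
by have := directed_le tour; rewrite card_ord.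
Qed.

(** * Tournaments from sign functions *)

Section FromSign.

Local Open Scope nat_scope.
Local Open Scope set_scope.

Variables (T : finType) (x0 : T) (p : T -> T -> T -> bool).
Hypothesis p_cycle : forall a b c, p b c a = p a b c.
Hypothesis p_swap : forall a b c, uniq [:: a; b; c] -> p b a c = ~~ p a b c.

(** The picked direction q of the edge e is the one for which q followed by the
    third vertex of X is positive; the default value is only reached when e is
    not an edge of a triple X. *)
Definition tournament_of_sign : {ffun {set T} -> {ffun {set T} -> T * T}} :=
  [ffun X : {set T} => [ffun e : {set T} =>
     odflt (x0, x0) [pick q : T * T | is_orientation2 e q
       && [forall c in X :\: e, p q.1 q.2 c]]]].

Lemma tournament_of_signE a b c : uniq [:: a; b; c] ->
  tournament_of_sign [set a; b; c] [set a; b]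
  = if p a b c then (a, b) else (b, a).
Proof.
move=> u; have := u; rewrite uniq3P => /and3P[ab ac bc].
have DE : [set a; b; c] :\: [set a; b] = [set c].
  apply/setP=> z; rewrite !inE; case: (eqVneq z c) => [->|_].
    by rewrite !(eq_sym c) (negPf ac) (negPf bc) orbT.
  by rewrite orbF andNb.
have ok q : is_orientation2 [set a; b] q
    && [forall z in [set a; b; c] :\: [set a; b], p q.1 q.2 z] =
    (q == if p a b c then (a, b) else (b, a)).
  have -> : [forall z in [set a; b; c] :\: [set a; b], p q.1 q.2 z]
      = p q.1 q.2 c.
    rewrite DE; apply/forall_inP/idP => [|pq z /set1P-> //].
    by apply; rewrite set11.
  apply/andP/eqP => [[/andP[ne /eqP E] pq]|->]; last first.
    rewrite /is_orientation2; case: ifP => /= pab.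
      by rewrite ab eqxx pab.
    by rewrite eq_sym ab finset.setUC eqxx p_swap // pab.
  case: q ne E pq => x y /= ne E pq.
  have /set2P xab : x \in [set a; b] by rewrite E set21.
  have /set2P yab : y \in [set a; b] by rewrite E set22.
  case: xab yab ne pq => -> [] ->; rewrite ?eqxx // => _.
    by move=> ->.
  by rewrite p_swap // => /negPf->.
rewrite !ffunE; case: pickP => [q|/(_ (if p a b c then (a, b) else (b, a)))].
  by rewrite ok => /eqP.
by rewrite ok eqxx.
Qed.

Lemma pos_tournament_of_sign a b c : uniq [:: a; b; c] ->
  pos tournament_of_sign a b c = p a b c.
Proof.
move=> u; rewrite /pos tournament_of_signE //.
have := u; rewrite uniq3P => /and3P[ab _ _].
by case: (p a b c); rewrite ?eqxx // xpair_eqE (eq_sym b) (negPf ab).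
Qed.

Lemma is_tournament_of_sign : is_tournament3 tournament_of_sign.
Proof.
apply/forall_inP => X /[!inE] /andP[_ /eqP cX]; apply/andP; split.
  apply/forall_inP => e /[!inE] /andP[eX /eqP ce].
  have [a [b [c [u -> ->]]]] := set3_edge cX eX ce.
  have := u; rewrite uniq3P => /and3P[ab _ _].
  rewrite tournament_of_signE // /is_orientation2; case: ifP => _ /=.
    by rewrite ab eqxx.
  by rewrite eq_sym ab finset.setUC eqxx.
apply/forall_inP => e /[!inE] /andP[eX /eqP ce].
apply/forall_inP => f /[!inE] /andP[fX /eqP cf]; apply/implyP => ef.
apply/forall_inP => x /[!inE] /andP[xe xf].
have [y [z [u eE fE XE]]] := set3_edges cX eX fX ce cf ef xe xf.
have u' : uniq [:: x; z; y].
  by move: u; rewrite !uniq3P (eq_sym z) => /and3P[-> -> ->].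
have := u; rewrite uniq3P => /and3P[/negPf xy /negPf xz _].
rewrite eE fE XE tournament_of_signE // finset.setUAC tournament_of_signE //.
rewrite (p_cycle y x z) (p_swap u) /edge_sign.
by case: (p x y z); rewrite /= ?eqxx ?xy ?xz.
Qed.

End FromSign.

(** * The lower bound *)

Section RandomTournament.

Local Open Scope nat_scope.
Local Open Scope set_scope.

(** Two independent fair events, with independence witnessed by maps that toggle
    one of them and fix the other. *)
Lemma card_quarter (G : finType) (f1 f2 : G -> G) (P Q : pred G) :
    injective f1 -> injective f2 ->
    (forall g, P (f1 g) = ~~ P g) -> (forall g, Q (f1 g) = Q g) ->
    (forall g, P (f2 g) = P g) -> (forall g, Q (f2 g) = ~~ Q g) ->
  4 * #|[set g | P g && Q g]| = #|G|.
Proof.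
move=> inj1 inj2 P1 Q1 P2 Q2.
pose s (h : G -> bool) : nat := \sum_g h g.
have sE : #|[set g | P g && Q g]| = s (fun g => P g && Q g).
  by rewrite -sum1_card big_mkcond; apply: eq_bigr => g _; rewrite inE; case: ifP.
have s1 : s (fun g => P g && Q g) = s (fun g => ~~ P g && Q g).
  by rewrite /s (reindex_inj inj1); apply: eq_bigr => g _; rewrite P1 Q1.
have s2 : s (fun g => P g && Q g) = s (fun g => P g && ~~ Q g).
  by rewrite /s (reindex_inj inj2); apply: eq_bigr => g _; rewrite P2 Q2.
have s3 : s (fun g => ~~ P g && Q g) = s (fun g => ~~ P g && ~~ Q g).
  by rewrite /s (reindex_inj inj2); apply: eq_bigr => g _; rewrite P2 Q2.
have -> : #|G| = s (fun g => P g && Q g) + s (fun g => ~~ P g && Q g)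
    + s (fun g => P g && ~~ Q g) + s (fun g => ~~ P g && ~~ Q g).
  rewrite -sum1_card -!big_split; apply: eq_bigr => g _.
  by case: (P g) (Q g) => [] [].
by rewrite sE -s3 -s2 -s1; lia.
Qed.

Variable n : nat.
Let T := 'I_n.+1.
Let G := {ffun {set T} -> bool}.
Implicit Types (g : G) (e : {set T}) (a b c d : T).

(** A tournament encoded by the graph g of the pairs on which it disagrees with
    the usual order; as g is arbitrary, averaging over g is averaging over all
    tournaments. *)
Definition arc g a b : bool := (a < b) (+) g [set a; b].

Lemma arcN g a b : a != b -> arc g b a = ~~ arc g a b.
Proof.
move=> ab; rewrite /arc (finset.setUC [set b]) -addNb; congr (_ (+) _).
by rewrite -leqNgt ltn_neqAle val_eqE eq_sym ab.
Qed.

(** The parity of the number of arcs that agree with the cycle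
    a -> b -> c -> a. Reversing the cycle negates the three terms, hence their
    sum. *)
Definition arc_sign g a b c : bool := arc g a b (+) arc g b c (+) arc g c a.

Lemma arc_sign_cycle g a b c : arc_sign g b c a = arc_sign g a b c.
Proof. by rewrite /arc_sign addbC addbA. Qed.

Lemma arc_sign_swap g a b c : uniq [:: a; b; c] ->
  arc_sign g b a c = ~~ arc_sign g a b c.
Proof.
rewrite uniq3P /arc_sign => /and3P[ab ac bc].
rewrite (arcN _ ab) (arcN _ bc) -(negbK (arc g a c)) -(arcN _ ac).
by case: (arc g a b) (arc g b c) (arc g c a) => [] [] [].
Qed.

Definition reverse_arc e g : G := [ffun f => g f (+) (f == e)].

Lemma reverse_arc_inj e : injective (reverse_arc e).
Proof.
apply: (can_inj (g := reverse_arc e)) => g; apply/ffunP => f.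
by rewrite !ffunE -addbA addbb addbF.
Qed.

Lemma arc_reverse e g a b : arc (reverse_arc e g) a b = arc g a b (+) ([set a; b] == e).
Proof. by rewrite /arc ffunE addbA. Qed.

Definition arc_tournament g := tournament_of_sign ord0 (arc_sign g).

Lemma arc_tournamentP g : is_tournament3 (arc_tournament g).
Proof.
by apply: is_tournament_of_sign; [apply: arc_sign_cycle | apply: arc_sign_swap].
Qed.

(** Each arc occurs in two of the four triples, so the four signs satisfy one
    linear relation, and two of the three conditions for being directed imply
    the last. *)
Lemma directed_arc_tournament g a b c d : uniq [:: a; b; c; d] ->
    arc_sign g a b c != arc_sign g a b d ->
    arc_sign g a b c = arc_sign g a c d ->
  directed4 (arc_tournament g) [set a; b; c; d].
Proof.
move=> u; rewrite /arc_sign => D1 D2.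
apply: pos_directed4; [exact: arc_tournamentP | exact: card_set4 |].
move=> x y z w u' sub.
have := u'; rewrite uniq4P => /and5P[xy xz xw yz /andP[yw zw]].
rewrite !pos_tournament_of_sign ?uniq3P ?xy ?xz ?xw ?yz ?yw //;
  try exact: arc_sign_swap.
(* Written with the six arcs of increasing pairs, each of the 24 conditions is
   a boolean consequence of D1 and D2. *)
have := u; rewrite uniq4P => /and5P[ab ac ad bc /andP[bd cd]].
have N : (arc g b a = ~~ arc g a b) * (arc g c a = ~~ arc g a c)
  * (arc g d a = ~~ arc g a d) * (arc g c b = ~~ arc g b c)
  * (arc g d b = ~~ arc g b d) * (arc g d c = ~~ arc g c d).
  by do !split; apply: arcN.
have [xY yY zY wY] : [/\ x \in [set a; b; c; d], y \in [set a; b; c; d],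
    z \in [set a; b; c; d] & w \in [set a; b; c; d]].
  by split; apply: sub; rewrite !inE eqxx ?orbT.
move: D1 D2; rewrite !N => D1 D2; rewrite /arc_sign.
move: xY yY zY wY; rewrite set4_mem !inE.
case/or4P=> /eqP xE; case/or4P=> /eqP yE; move: xy xz xw yz yw zw;
  rewrite xE yE ?eqxx // => _ xz xw yz yw zw;
  case/or4P=> /eqP zE; move: xz xw yz yw zw; rewrite zE ?eqxx // => _ xw _ yw zw;
  case/or4P=> /eqP wE; move: xw yw zw; rewrite wE ?eqxx // => _ _ _;
  rewrite !N; move: D1 D2;
  by case: (arc g a b) (arc g a c) (arc g a d) (arc g b c) (arc g b d) (arc g c d)
    => [] [] [] [] [] [].
Qed.

Lemma arc_sign_reverse g a b c : uniq [:: a; b; c] ->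
  arc_sign (reverse_arc [set a; b] g) a b c = ~~ arc_sign g a b c.
Proof.
rewrite uniq3P => /and3P[_ ac bc]; rewrite /arc_sign !arc_reverse eqxx.
have no_c x y : c \in [set x; y] -> ([set x; y] == [set a; b]) = false.
  move=> cxy; apply/eqP=> E; move: cxy.
  by rewrite E !inE !(eq_sym c) (negPf ac) (negPf bc).
rewrite !no_c ?inE ?eqxx ?orbT // !addbF.
by case: (arc g a b) (arc g b c) (arc g c a) => [] [] [].
Qed.

Lemma arc_sign_reverse_id e g a b c : ~~ (e \subset [set a; b; c]) ->
  arc_sign (reverse_arc e g) a b c = arc_sign g a b c.
Proof.
move=> esub; have no_e x y : x \in [set a; b; c] -> y \in [set a; b; c] ->
    ([set x; y] == e) = false.
  move=> xs ys; apply: contraNF esub => /eqP<-.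
  by rewrite finset.subUset !finset.sub1set xs.
by rewrite /arc_sign !arc_reverse !no_e ?addbF // !inE eqxx ?orbT.
Qed.

(** Let P compare the signs of abc and abd, and Q those of abc and acd. The arc
    ac lies in abc and acd, so reversing it toggles P and fixes Q; the
    arc ab lies in abc and abd, so reversing it fixes P and toggles Q. *)
Lemma directed_quarter (Y : {set T}) : #|Y| = 4 ->
  #|G| <= 4 * #|[set g | directed4 (arc_tournament g) Y]|.
Proof.
move=> /set4P[a [b [c [d [u ->]]]]].
pose P g := arc_sign g a b c != arc_sign g a b d.
pose Q g := arc_sign g a b c == arc_sign g a c d.
have := u; rewrite uniq4P => /and5P[ab ac ad bc /andP[bd cd]].
have uabc : uniq [:: a; b; c] by rewrite uniq3P ab ac.
have uabd : uniq [:: a; b; d] by rewrite uniq3P ab ad.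
have uacd : uniq [:: a; c; d] by rewrite uniq3P ac ad.
have out v w x y z : uniq [:: w; x; y; z] ->
    ~~ ([set v; w] \subset [set x; y; z]).
  rewrite uniq4P => /and5P[/negPf wx /negPf wy /negPf wz _ _].
  by rewrite finset.subUset !finset.sub1set !inE wx wy wz andbF.
have ac_abc g : arc_sign (reverse_arc [set a; c] g) a b c = ~~ arc_sign g a b c.
  rewrite !(arc_sign_cycle _ c a b) (finset.setUC [set a]) arc_sign_reverse //.
  by rewrite -(rot_uniq 1).
rewrite -(@card_quarter _ (reverse_arc [set a; c]) (reverse_arc [set a; b]) P Q).
- rewrite leq_mul2l /=; apply: subset_leq_card; apply/fintype.subsetP => g.
  rewrite !inE => /andP[Pg /eqP Qg]; exact: directed_arc_tournament.
- exact: reverse_arc_inj.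
- exact: reverse_arc_inj.
- move=> g; rewrite /P ac_abc arc_sign_reverse_id.
    by case: (arc_sign g a b c) (arc_sign g a b d) => [] [].
  by apply: out; rewrite uniq4P !(eq_sym c) ac bc eq_sym cd ab ad.
- move=> g; rewrite /Q ac_abc arc_sign_reverse //.
  by case: (arc_sign g a b c) (arc_sign g a c d) => [] [].
- move=> g; rewrite /P !arc_sign_reverse //.
  by case: (arc_sign g a b c) (arc_sign g a b d) => [] [].
- move=> g; rewrite /Q arc_sign_reverse // arc_sign_reverse_id.
    by case: (arc_sign g a b c) (arc_sign g a c d) => [] [].
  by apply: out; rewrite uniq4P eq_sym ab bc bd ac ad.
Qed.

Lemma M3_ge : 'C(n.+1, 4) <= 4 * M3 n.+1.
Proof.
have G0 : 0 < #|G| by apply/card_gt0P; exists [ffun=> false].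
rewrite -(leq_pmul2r G0).
have -> : 'C(n.+1, 4) = #|[set Y : {set T} | #|Y| == 4]|.
  by rewrite card_draws card_ord.
rewrite -sum_nat_const.
apply: (@leq_trans (4 * \sum_(g : G) #|[set Y | directed4 (arc_tournament g) Y]|)).
  have cE (I : finType) (P : pred I) : #|[set i | P i]| = \sum_i P i.
    by rewrite -sum1_card big_mkcond; apply: eq_bigr => i _; rewrite inE; case: (P i).
  under [X in _ <= 4 * X]eq_bigr => g _ do rewrite cE.
  rewrite exchange_big big_distrr big_mkcond; apply: leq_sum => Y _ /=.
  rewrite inE -cE; case: eqP => // cY; exact: directed_quarter.
rewrite -mulnA leq_mul2l /= mulnC -sum_nat_const; apply: leq_sum => g _.
by rewrite /M3 (leq_bigmax_cond (arc_tournament g)) // arc_tournamentP.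
Qed.

End RandomTournament.

(** * The limit *)

Theorem corollary2p3 (R : realType) :
  cvgn (density3 R) /\ c3 R = 1 / 4.
Proof.
suff lim : (density3 R n @[n --> \oo] --> (1 / 4 : R))%classic.
  by split; [apply/cvg_ex; exists (1 / 4) | apply/cvg_lim].
rewrite -(cvg_shiftn 4).
apply: (@squeeze_cvgr _ _ _ _ (fun=> 1 / 4) (fun n => 1 / 4 + 3 / 4 * harmonic n)).
(* For n + 4 vertices the upper bound is (n + 4) / (4 (n + 1)), that is
     1/4 + (3/4) / (n + 1). *)
- near=> n; rewrite /density3 /= addn4.
  have C0 : 0 < 'C(n.+4, 4)%:R :> R by rewrite ltr0n bin_gt0.
  rewrite ler_pdivlMr // ler_pdivrMr //; apply/andP; split.
    have := M3_ge n.+3; rewrite -(ler_nat R) natrM; lra.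
  have := M3_le n.+4; have := bin_ffact n.+4 4.
  rewrite (_ : 4`! = 24)%N // !ffactnS ffactn0 muln1 /= => CE le.
  have : (4 * M3 n.+4 * n.+1 <= 'C(n.+4, 4) * n.+4)%N by nia.
  rewrite -(ler_nat R) !natrM => le'.
  have n0 : 0 < n.+1%:R :> R by rewrite ltr0n.
  rewrite [leRHS](_ : _ = 'C(n.+4, 4)%:R * n.+4%:R / (4 * n.+1%:R)).
    by rewrite ler_pdivlMr ?mulr_gt0 //; lra.
  have -> : n.+4%:R = n.+1%:R + 3 :> R by rewrite -natrD addnC.
  by rewrite /harmonic; field; rewrite gt_eqF.
- exact: cvg_cst.
- rewrite -[X in (_ --> X)%classic]addr0 -[X in 1 / 4 + X](mulr0 (3 / 4)).
  by apply: cvgD; [exact: cvg_cst | apply: cvgMr; exact: cvg_harmonic].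
Unshelve. all: by end_near.
Qed.
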